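(* Let $G$ be a connected graph with $s$ vertices and $m$ edges, let $\upsilon_r(G)$ be its $r$-th weak edge biparticity and $\lambda_r(G)$ its $r$-th edge connectivity. Let $A$ be the incidence matrix of $G$ over a field $K$ of characteristic $p\geq 0$, and let $\mathbb{X}$ be the set of points of $\mathbb{P}^{s-1}$ defined by the column vectors of $A$. Then $$ \delta_\mathbb{X}(d,r)=\delta_r(C_\mathbb{X}(d))=\begin{cases} \upsilon_r(G)&\text{if } d=1,\ p\neq 2,\ G \text{ is non-bipartite},\ 1\leq r\leq s,\\ \lambda_r(G)&\text{if } d=1,\ p=2,\ 1\leq r\leq s-1,\\ \lambda_r(G)&\text{if } d=1,\ G\text{ is bipartite},\ 1\leq r\leq s-1,\\ r&\text{if } d\geq 2\text{ and }1\leq r\leq m. \end{cases} $$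
   Context: Graphs are finite and simple. Let $G$ be a graph with vertices $t_1,\ldots,t_s$ and edges $f_1,\ldots,f_m$. Incidence matrix: the $s\times m$ matrix $A=(a_{ij})$ over $K$ with $a_{ij}=1$ if $t_i\in f_j$ and $a_{ij}=0$ otherwise. Let $P_1,\ldots,P_m\in K^s$ be its columns and $\mathbb{X}=\{[P_1],\ldots,[P_m]\}\subset\mathbb{P}^{s-1}$ the corresponding set of points in projective space over $K$. Graph invariants: the $r$-th weak edge biparticity $\upsilon_r(G)$ is the minimum number of edges of $G$ whose removal results in a graph with $r$ bipartite connected components, and maybe some non-bipartite connected components (an isolated vertex is a bipartite component). The $r$-th edge connectivity $\lambda_r(G)$ is the minimum number of edges whose removal results in a graph with $r+1$ connected components. Let $S=K[t_1,\ldots,t_s]=\bigoplus_{d\geq 0}S_d$ with the standard grading (the vertices are identified with the variables). The vanishing ideal $I(\mathbb{X})$ is the graded ideal of $S$ generated by the homogeneous polynomials vanishing at all points of $\mathbb{X}$. For a finite set $F$ of homogeneous polynomials, $V_\mathbb{X}(F)$ is the set of common zeros of $F$ in $\mathbb{X}$. For integers $d,r\geq 1$, $$\delta_\mathbb{X}(d,r)=\min\{|\mathbb{X}\setminus V_\mathbb{X}(F)| : F=\{f_i\}_{i=1}^r\subset S_d,\ \dim_K(\{\overline{f}_i\}_{i=1}^r)=r\},$$ where $\overline{f}_i=f_i+I(\mathbb{X})$ and $\dim_K(\{\overline f_i\}_{i=1}^r)$ is the dimension of the $K$-span of these classes in $S/I(\mathbb{X})$. The projective Reed--Muller-type code $C_\mathbb{X}(d)$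 is the image of the linear map ${\rm ev}_d\colon S_d\to K^m$, $f\mapsto(f(P_1),\ldots,f(P_m))$. For a linear subspace $C\subset K^m$ and $1\leq r\leq\dim_K C$, the $r$-th generalized Hamming weight is $\delta_r(C)=\min\{|\chi(D)| : D\text{ a subspace of }C,\ \dim_K D=r\}$, where $\chi(D)=\{i : \exists\,(a_1,\ldots,a_m)\in D,\ a_i\neq 0\}$. *)

(* Defs.v *)
From HB Require Import structures.
From mathcomp Require Import all_boot all_order all_algebra.
From mathcomp Require Import finmap.
From mathcomp Require Import boolp.
From mathcomp Require Import mpoly.

Set Implicit Arguments.
Unset Strict Implicit.
Unset Printing Implicit Defensive.

Import GRing.Theory.
Local Open Scope ring_scope.

(* Minima are stated relationally, so that asserting [is_min P k] includes the
   assertion that the set P of values is nonempty. *)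
Definition is_min (P : nat -> Prop) (k : nat) : Prop :=
  P k /\ forall l, P l -> (k <= l)%N.

Record sgraph (s : nat) := SGraph {
  edges : {set {set 'I_s}};
  edges_card2 : [forall e in edges, #|e| == 2] }.

Section Graphs.
Variable s : nat.
Implicit Types (G : sgraph s) (C : {set 'I_s}) (D : {set {set 'I_s}}).

Definition adj G : rel 'I_s := fun x y => [set x; y] \in edges G.

Definition components G : {set {set 'I_s}} :=
  [set [set y | connect (adj G) x y] | x : 'I_s].

Definition connected G : bool := #|components G| == 1%N.

Definition bipartite G : bool :=
  [exists U : {set 'I_s}, [forall e in edges G, #|e :&: U| == 1%N]].

Lemma remove_edges_card2 G D : [forall e in edges G :\: D, #|e| == 2].
Proof.
apply/forall_inP => e /setDP[eG _].
exact: (forall_inP (edges_card2 G)) e eG.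
Qed.

Definition remove_edges G D : sgraph s := SGraph (remove_edges_card2 G D).

Lemma induced_card2 G C :
  [forall e in [set e in edges G | e \subset C], #|e| == 2].
Proof.
apply/forall_inP => e; rewrite inE => /andP[eG _].
exact: (forall_inP (edges_card2 G)) e eG.
Qed.

(* G[C], with the vertices outside C kept as isolated vertices; this does not
   affect bipartiteness. *)
Definition induced G C : sgraph s := SGraph (induced_card2 G C).

Definition bipartite_components G : {set {set 'I_s}} :=
  [set C in components G | bipartite (induced G C)].

(* upsilon_r(G) = k *)
Definition is_weak_edge_biparticity G (r : nat) : nat -> Prop :=
  is_min (fun k => exists D, [/\ D \subset edges G,
    #|bipartite_components (remove_edges G D)| = r & #|D| = k]).

(* lambda_r(G) = k *)
Definition is_edge_connectivity G (r : nat) : nat -> Prop :=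
  is_min (fun k => exists D, [/\ D \subset edges G,
    #|components (remove_edges G D)| = r.+1 & #|D| = k]).

End Graphs.

Definition incidence (K : fieldType) (s m : nat) (f : 'I_m -> {set 'I_s}) :
  'M[K]_(s, m) := \matrix_(i, j) (i \in f j)%:R.

(* The dimension, in the quotient of V by the subspace I, of the span of the
   classes of the vectors v_i is k: this span has a basis consisting of the
   classes of k vectors b_j. *)
Definition is_dim_span_mod (K : fieldType) (V : lmodType K) (I : V -> Prop)
    (r : nat) (v : 'I_r -> V) (k : nat) : Prop :=
  exists b : 'I_k -> V,
    [/\ forall c : 'I_k -> K, I (\sum_j c j *: b j) -> forall j, c j = 0,
        forall j, exists c : 'I_r -> K, I (b j - \sum_i c i *: v i)
      & forall i, exists c : 'I_k -> K, I (v i - \sum_j c j *: b j)].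

Section ProjectivePoints.
Variables (K : fieldType) (s : nat).

(* Points of P^(s-1) are the lines of K^s, so [P] is <[P]>%VS for P != 0. *)
Local Notation point := {vspace 'cV[K]_s}.

Definition vanishes_at (g : {mpoly K[s]}) (x : point) : bool :=
  `[< forall v, v \in x -> v != 0 -> g.@[fun i => v i 0] = 0 >].

Definition column_points (m : nat) (A : 'M[K]_(s, m)) : {fset point} :=
  [fset <[col j A]>%VS | j in 'I_m]%fset.

Variable X : {fset point}.

Definition vanishing_ideal (g : {mpoly K[s]}) : Prop :=
  exists N (h q : 'I_N -> {mpoly K[s]}),
    (forall i, (exists e, q i \is e.-homog) /\
               (forall x, x \in X -> vanishes_at (q i) x)) /\
    g = \sum_i h i * q i.

Definition zeros (r : nat) (F : 'I_r -> {mpoly K[s]}) : {fset point} :=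
  [fset x in X | [forall i, vanishes_at (F i) x]]%fset.

(* delta_X(d,r) = k *)
Definition is_gmd (d r : nat) : nat -> Prop :=
  is_min (fun k => exists F : 'I_r -> {mpoly K[s]},
    [/\ forall i, F i \is d.-homog,
        is_dim_span_mod vanishing_ideal F r
      & #|` (X `\` zeros F)%fset| = k]).

End ProjectivePoints.

Section Codes.
Variables (K : fieldType) (m : nat).

(* The library makes the space [dhomog s K d] of forms of degree d
   finite-dimensional only when the number of variables s is a successor. *)
Definition ev (n d : nat) (A : 'M[K]_(n.+1, m)) (g : dhomog n.+1 K d) :
  'rV[K]_m := \row_j (mpoly_of_dhomog g).@[fun i => A i j].

Fact ev_is_linear n d (A : 'M[K]_(n.+1, m)) : linear (@ev n d A).
Proof.
by move=> a g h; apply/rowP=> j; rewrite !mxE mpoly_of_dhomog_is_linear mevalD mevalZ.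
Qed.

HB.instance Definition _ n d (A : 'M[K]_(n.+1, m)) :=
  GRing.isLinear.Build K (dhomog n.+1 K d) 'rV[K]_m _ (@ev n d A)
    (@ev_is_linear n d A).

(* C_X(d), for the points represented by the columns of A *)
Definition code n (A : 'M[K]_(n.+1, m)) (d : nat) : {vspace 'rV[K]_m} :=
  limg (linfun (@ev n d A)).

Definition chi (D : {vspace 'rV[K]_m}) : {set 'I_m} :=
  [set i | `[< exists2 a, a \in D & a 0 i != 0 >]].

(* delta_r(C) = k *)
Definition is_ghw (C : {vspace 'rV[K]_m}) (r : nat) : nat -> Prop :=
  is_min (fun k => exists D : {vspace 'rV[K]_m},
    [/\ (D <= C)%VS, \dim D = r & #|chi D| = k]).

End Codes.

(* Main.v *)
Require Import Defs.
From HB Require Import structures.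
From mathcomp Require Import all_boot all_order all_algebra.
From mathcomp Require Import finmap.
From mathcomp Require Import boolp.
From mathcomp Require Import mpoly.

Set Implicit Arguments.
Unset Strict Implicit.
Unset Printing Implicit Defensive.

Import GRing.Theory.
Local Open Scope ring_scope.

(** For a code [C], write [C :&: supported J] for its words supported on the
    set [J] of positions. Enlarging [J] by one position raises the dimension of
    this space by at most one, so [delta_r C] is the least [#|J|] for which
    that dimension is exactly [r] ([is_ghw_supported]). Sending a form to its
    values at the columns of the matrix embeds the forms of degree [d] modulo
    the vanishing ideal in [K^m] with image [C_X(d)], and nonzeros correspond to
    points outside the zero set; so [delta_X(d, r)] is the same minimum
    ([is_gmd_ghw]).

    In degree one a linear form is a labelling [u] of the vertices, and its
    value at the edge [{x, y}] is [u x + u y]. Its word is supported on the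
    edge set [J] exactly when [u] alternates, [u y = - u x], along every edge
    of [G - J]. On a connected component such a labelling is determined by one
    value, and a nonzero value is possible exactly when the component is
    bipartite or [2 = 0] in [K]. Hence the space of these labellings has as
    dimension the number of bipartite components of [G - J], or of all its
    components if [K] has characteristic two or [G] is bipartite
    ([dim_alternating]). Subtracting the labellings alternating on all of [G],
    which form the kernel of evaluation and have dimension 0 or 1, gives the
    dimension of [C :&: supported J] ([ghw_edge_removal]); the minimum above is
    then the weak edge biparticity or the edge connectivity.

    In degree at least two the monomial [x^(d-1) y] is nonzero only at the edge
    [{x, y}], so the code is the whole of [K^m] ([code_ge2]), where [supported J]
    has dimension [#|J|]. *)

(** * Minima *)

Lemma is_min_exists (P : nat -> Prop) : (exists k, P k) -> exists k, is_min P k.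
Proof.
move=> [k Pk].
have exP : exists k, `[< P k >] by exists k; apply/asboolP.
exists (ex_minn exP); case: ex_minnP => l /asboolP Pl lmin.
by split=> // i Pi; apply/lmin/asboolP.
Qed.

(** Replacing a set of values by another one that is dominated in both
    directions does not change the minimum; this absorbs the difference
    between exact and at-least conditions. *)
Lemma is_min_cofinal (P Q : nat -> Prop) k :
    (forall i, P i -> exists2 j, (j <= i)%N & Q j) ->
    (forall j, Q j -> exists2 i, (i <= j)%N & P i) ->
  is_min P k -> is_min Q k.
Proof.
move=> PQ QP [Pk kmin].
have Qmin l : Q l -> (k <= l)%N.
  by case/QP=> i le_il /kmin /leq_trans->.
split=> //; have [j le_jk Qj] := PQ k Pk.
by have/eqP <- : j == k by rewrite eqn_leq le_jk Qmin.
Qed.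

Lemma is_min_iff (P Q : nat -> Prop) k :
  (forall i, P i <-> Q i) -> is_min P k -> is_min Q k.
Proof. by move=> PQ; apply: is_min_cofinal => i /PQ; exists i. Qed.

(** * Subspaces of coordinate spaces *)

Section CoordinateSpaces.
Variable K : fieldType.

Section Dimension.
Variables (s : nat) (V : {vspace 'rV[K]_s}).
Variables (T : finType) (P : {set T}) (p : T -> 'I_s).

Let read : 'Hom('rV[K]_s, 'rV[K]_#|P|) :=
  linfun (colsub (fun k => p (enum_val k))).

Let readE u k : read u 0 k = u 0 (p (enum_val k)).
Proof. by rewrite lfunE mxE. Qed.

Hypothesis detect :
  forall u, u \in V -> {in P, forall k, u 0 (p k) = 0} -> u = 0.

Let read_inj : (V :&: lker read)%VS = 0%VS.
Proof.
apply/eqP; rewrite -subv0; apply/subvP => u /memv_capP[uV].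
rewrite memv_ker memv0 => /eqP u0; apply/eqP/detect => // k kP.
by have := readE u (enum_rank_in kP k); rewrite u0 mxE enum_rankK_in.
Qed.

(** Evaluation at the detecting coordinates is then an isomorphism. *)
Lemma dim_dual_coordinates :
    (forall k, k \in P -> exists u, [/\ u \in V, u 0 (p k) != 0
                            & {in P, forall l, l != k -> u 0 (p l) = 0}]) ->
  \dim V = #|P|.
Proof.
move=> dual; rewrite -(limg_dim_eq read_inj).
suff -> : (read @: V = fullv)%VS by rewrite dimvf dim_matrix mul1r.
apply/eqP; rewrite eqEsubv subvf /=; apply/subvP => w _.
rewrite [w]row_sum_delta memv_suml // => k _; apply: rpredZ.
have [u [uV uk ul]] := dual _ (enum_valP k).
apply/memv_imgP; exists ((u 0 (p (enum_val k)))^-1 *: u); first exact: rpredZ.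
apply/rowP => l; rewrite linearZ [RHS]mxE readE [LHS]mxE eqxx /=.
have [->|ne_lk] := eqVneq l k; first by rewrite mulVf.
by rewrite (ul _ (enum_valP l)) ?mulr0 ?(inj_eq enum_val_inj).
Qed.

End Dimension.

Variable m : nat.
Implicit Types (J : {set 'I_m}) (C D : {vspace 'rV[K]_m}).

Definition restrict_to J : 'M[K]_m := diag_mx (\row_j (j \in J)%:R).

(** The words supported on [J] form the kernel of the restriction to the
    complement, which makes them a subspace by construction. *)
Definition supported J : {vspace 'rV[K]_m} :=
  lker (linfun (mulmxr (restrict_to (~: J)))).

Lemma supportedP J (a : 'rV[K]_m) :
  reflect (forall j, j \notin J -> a 0 j = 0) (a \in supported J).
Proof.
have E j : (linfun (mulmxr (restrict_to (~: J))) a) 0 j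
         = a 0 j * (j \notin J)%:R.
  by rewrite lfunE /= mul_mx_diag !mxE inE.
rewrite memv_ker; apply: (iffP eqP) => [a0 j jJ|a0].
  by have := E j; rewrite a0 jJ mulr1 mxE.
apply/rowP => j; rewrite E mxE; case: (boolP (j \in J)) => jJ; first by rewrite mulr0.
by rewrite a0 ?mul0r.
Qed.

Lemma sub_supported D J : (D <= supported J)%VS = (chi D \subset J).
Proof.
apply/subvP/subsetP => [DJ j|DJ a aD].
  rewrite inE => /asboolP[a /DJ/supportedP aJ]; apply: contraNT => /aJ ->.
  exact: eqxx.
apply/supportedP => j; apply: contraNeq => aj.
by apply: DJ; rewrite inE; apply/asboolP; exists a.
Qed.

Lemma dim_supported J : \dim (supported J) = #|J|.
Proof.
apply: (@dim_dual_coordinates _ _ _ _ id) => [u /supportedP uJ u0|k kJ].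
  by apply/rowP => j; rewrite mxE; case: (boolP (j \in J)) => [/u0|/uJ].
exists (delta_mx 0 k); split.
- apply/supportedP => j; apply: contraNeq; rewrite mxE /=.
  by case: (j =P k) => [->|] //; rewrite eqxx.
- by rewrite mxE !eqxx oner_eq0.
- by move=> l _ /negPf lk; rewrite mxE lk andbF.
Qed.

Lemma supported0 : supported set0 = 0%VS.
Proof. by apply/eqP; rewrite -dimv_eq0 dim_supported cards0. Qed.

Lemma supportedT : supported setT = fullv.
Proof.
apply/eqP; rewrite eqEsubv subvf /=; apply/subvP => a _.
by apply/supportedP => j; rewrite in_setT.
Qed.

(** Vanishing at one further coordinate is a single linear equation. *)
Lemma dim_cap_supported_step C J j :
  (\dim (C :&: supported J) <= (\dim (C :&: supported (J :\ j))).+1)%N.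
Proof.
pose h := linfun (colsub (fun _ : 'I_1 => j)) : 'Hom('rV[K]_m, 'rV[K]_1).
set V := (C :&: supported J)%VS.
rewrite -(limg_ker_dim h V) -[X in (_ <= X)%N]addn1 leq_add //; last first.
  by rewrite (leq_trans (dimvS (subvf _))) // dimvf dim_matrix.
apply/dimvS/subvP => u /memv_capP[/memv_capP[uC /supportedP uJ]].
rewrite memv_ker lfunE => /eqP uj; apply/memv_capP; split=> //.
apply/supportedP => i; rewrite !inE negb_and negbK => /orP[/eqP->|/uJ //].
by have /rowP/(_ 0) := uj; rewrite !mxE.
Qed.

(** Deleting coordinates of [J] one at a time lowers the dimension by at most
    one at each step, so every smaller dimension is attained on the way. *)
Lemma exists_subset_dim_eq C J r :
    (r <= \dim (C :&: supported J))%N ->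
  exists2 J' : {set 'I_m}, J' \subset J & \dim (C :&: supported J') = r.
Proof.
elim: {J}_.+1 {-2}J (ltnSn #|J|) => // c IH J leJ.
rewrite leq_eqVlt => /predU1P[->|ltr]; first by exists J.
have [J0|[j jJ]] := set_0Vmem J.
  by rewrite J0 supported0 capv0 dimv0 in ltr.
have [||J' sJ' dJ'] := IH (J :\ j).
- by move: leJ; rewrite (cardsD1 j) jJ.
- by rewrite -ltnS (leq_trans ltr) // dim_cap_supported_step.
by exists J' => //; apply: subset_trans sJ' (subsetDl _ _).
Qed.

(** A subcode [D] lies in [C :&: supported (chi D)], and conversely every
    [C :&: supported J] of dimension [r] is a subcode with at most [#|J|]
    nonzero positions. *)
Lemma is_ghw_supported C r k : is_ghw C r k <->
  is_min (fun l => exists J, \dim (C :&: supported J) = r /\ #|J| = l) k.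
Proof.
have ghw_le i : (exists D, [/\ (D <= C)%VS, \dim D = r & #|chi D| = i]) ->
    exists2 j, (j <= i)%N & exists J, \dim (C :&: supported J) = r /\ #|J| = j.
  case=> D [sDC dD <-].
  have [|J sJ dJ] := @exists_subset_dim_eq C (chi D) r.
    by rewrite -dD dimvS // subv_cap sDC sub_supported subxx.
  by exists #|J|; [apply: subset_leq_card | exists J].
have le_ghw j : (exists J, \dim (C :&: supported J) = r /\ #|J| = j) ->
    exists2 i, (i <= j)%N & exists D, [/\ (D <= C)%VS, \dim D = r & #|chi D| = i].
  case=> J [dJ <-]; exists #|chi (C :&: supported J)%VS|.
    by apply: subset_leq_card; rewrite -sub_supported capvSr.
  by exists (C :&: supported J)%VS; split; first exact: capvSl.
by split; apply: is_min_cofinal.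
Qed.

Lemma exists_ghw C r : (r <= \dim C)%N -> exists k, is_ghw C r k.
Proof.
move=> rC; have [|J _ dJ] := @exists_subset_dim_eq C setT r.
  by rewrite supportedT capvf.
have [|k kmin] := @is_min_exists
    (fun l => exists J, \dim (C :&: supported J) = r /\ #|J| = l).
  by exists #|J|, J.
by exists k; apply/is_ghw_supported.
Qed.

Lemma is_ghw_fullv r : (r <= m)%N -> is_ghw (fullv : {vspace 'rV[K]_m}) r r.
Proof.
move=> rm; apply/is_ghw_supported; split=> [|l [J]].
  have [|J _] := @exists_subset_dim_eq fullv setT r.
    by rewrite capfv dim_supported cardsT card_ord.
  by rewrite capfv dim_supported => dJ; exists J; rewrite capfv dim_supported.
by rewrite capfv dim_supported => -[<- <-].
Qed.

End CoordinateSpaces.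

(** * Vanishing ideals and evaluation codes *)

Section Evaluation.
Variables (K : fieldType) (n m : nat) (A : 'M[K]_(n.+1, m)).

Local Notation X := (column_points A).
Local Notation I := (vanishing_ideal X).

Definition values (g : {mpoly K[n.+1]}) : 'rV[K]_m :=
  \row_j g.@[fun i => A i j].

Fact values_is_linear : linear values.
Proof. by move=> a g h; apply/rowP => j; rewrite !mxE mevalD mevalZ. Qed.

HB.instance Definition _ := GRing.isLinear.Build K {mpoly K[n.+1]} 'rV[K]_m _
  values values_is_linear.

Lemma vanishing_ideal0 : I 0.
Proof. by exists 0, (fun=> 0), (fun=> 0); split=> [[]|] //; rewrite big_ord0. Qed.

Lemma vanishing_idealD g h : I g -> I h -> I (g + h).
Proof.
move=> [N1 [h1 [q1 [H1 ->]]]] [N2 [h2 [q2 [H2 ->]]]].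
pose glue T (u : 'I_N1 -> T) (v : 'I_N2 -> T) i :=
  match split i with inl j => u j | inr j => v j end.
exists (N1 + N2)%N, (glue _ h1 h2), (glue _ q1 q2); split.
  by move=> i; rewrite /glue; case: (split i).
rewrite big_split_ord /=; congr (_ + _); apply: eq_bigr => j _; rewrite /glue.
  by rewrite (unsplitK (inl j)).
by rewrite (unsplitK (inr j)).
Qed.

Lemma vanishing_idealZ (c : K) g : I g -> I (c *: g).
Proof.
move=> [N [h [q [H ->]]]]; exists N, (fun i => c *: h i), q; split=> //.
by rewrite scaler_sumr; apply: eq_bigr => i _; rewrite scalerAl.
Qed.

Lemma vanishing_ideal_sum N (g : 'I_N -> {mpoly K[n.+1]}) :
  (forall i, I (g i)) -> I (\sum_i g i).
Proof.
move=> Ig; apply: (big_ind I) => //; first exact: vanishing_ideal0.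
exact: vanishing_idealD.
Qed.

Lemma mem_column_points x :
  reflect (exists j, x = <[col j A]>%VS) (x \in X).
Proof.
apply: (iffP (imfsetP _ _ _ _)) => [[j _ ->]|[j ->]]; first by exists j.
by exists j.
Qed.

Lemma meval_scale d (g : {mpoly K[n.+1]}) c (v : 'I_n.+1 -> K) :
  g \is d.-homog -> g.@[fun i => c * v i] = c ^+ d * g.@[v].
Proof.
move=> /dhomogP hg; rewrite !mevalE mulr_sumr !big_seq.
apply: eq_bigr => w /hg <-; rewrite mulrCA; congr (_ * _).
rewrite [X in c ^+ X]mdegE -prodrXr -big_split /=; apply: eq_bigr => i _.
by rewrite exprMn.
Qed.

Hypothesis col_neq0 : forall j, col j A != 0.

Lemma vanishes_atP d (g : {mpoly K[n.+1]}) j :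
  g \is d.-homog -> vanishes_at g <[col j A]>%VS = (values g 0 j == 0).
Proof.
move=> hg; rewrite mxE; apply/asboolP/eqP => [/(_ _ (memv_line _) (col_neq0 j))|g0].
  by under meval_eq do rewrite mxE.
move=> v /vlineP[c ->] _; under meval_eq do rewrite !mxE.
by rewrite (meval_scale _ _ hg) g0 mulr0.
Qed.

Lemma values_vanishing g : I g -> values g = 0.
Proof.
move=> [N [h [q [Hq ->]]]]; rewrite linear_sum big1 // => i _.
have [[e he] q0] := Hq i; apply/rowP => j; rewrite !mxE mevalM.
suff /eqP : values (q i) 0 j == 0 by rewrite mxE => ->; rewrite mulr0.
by rewrite -(vanishes_atP _ he); apply/q0/mem_column_points; exists j.
Qed.

(** A form with zero values is itself one of the generators of the ideal. *)
Lemma vanishing_ideal_homog d g : g \is d.-homog -> I g <-> values g = 0.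
Proof.
move=> hg; split; first exact: values_vanishing.
move=> g0; exists 1%N, (fun=> 1), (fun=> g); split.
  move=> _; split; first by exists d.
  by move=> x /mem_column_points[j ->]; rewrite (vanishes_atP _ hg) g0 mxE.
by rewrite big_ord1 mul1r.
Qed.

Lemma memv_code d (a : 'rV[K]_m) :
  reflect (exists2 g : {mpoly K[n.+1]}, g \is d.-homog & values g = a)
          (a \in code A d).
Proof.
rewrite /code; apply: (iffP memv_imgP) => [[g _ ->]|[g hg <-]].
  exists (mpoly_of_dhomog g); first exact: dhomog_is_dhomog.
  by rewrite lfunE.
by exists (DHomog hg); rewrite ?memvf // lfunE.
Qed.

(** A row vector stands for the linear form with these coefficients. *)
Definition linear_forms : 'Hom('rV[K]_n.+1, 'rV[K]_m) := linfun (mulmxr A).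

Lemma linear_formsE u : linear_forms u = u *m A.
Proof. by rewrite lfunE. Qed.

Lemma code_linear_forms : code A 1 = limg linear_forms.
Proof.
have row_code i : linear_forms (delta_mx 0 i) = values 'X_i.
  by apply/rowP => j; rewrite linear_formsE -rowE !mxE mevalXU.
apply/vspaceP => a; apply/memv_code/idP => [[g /dhomogP hg <-]|/memv_imgP[u _ ->]].
  rewrite [g]mpolyE big_seq linear_sum; apply: rpred_sum => w /hg /eqP/mdeg1P[i /eqP->].
  by rewrite linearZ /= -row_code; apply/rpredZ/memv_img/memvf.
exists (\sum_i u 0 i *: 'X_i).
  by apply: rpred_sum => i _; apply: rpredZ; rewrite dhomogX /= mdeg1.
rewrite [u in RHS]row_sum_delta !linear_sum; apply: eq_bigr => i _.
by rewrite !linearZ /= -row_code.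
Qed.

(** By homogeneity the value of [F i] at a representative decides whether it
    vanishes at the point, and distinct columns give distinct points, so the
    points outside the zero set can be counted by columns. *)
Lemma card_nonzeros d r (F : 'I_r -> {mpoly K[n.+1]}) :
    injective (fun j => <[col j A]>%VS) -> (forall i, F i \is d.-homog) ->
  #|` (X `\` zeros X F)%fset| = #|chi <<[tuple values (F i) | i < r]>>%VS|.
Proof.
move=> line_inj hF; set D := (<<_>>)%VS.
have -> : (X `\` zeros X F)%fset
        = [fset <[col j A]>%VS | j in chi D]%fset.
  apply/fsetP => x; apply/fsetDP/imfsetP => [[/mem_column_points[j ->]]|[j jD ->]].
    have jX : <[col j A]>%VS \in X by apply/mem_column_points; exists j.
    rewrite !inE jX /= => /forallPn[i]; rewrite (vanishes_atP _ (hF i)) => Fij.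
    exists j => //; rewrite !inE; apply/asboolP; exists (values (F i)) => //.
    by apply: memv_span; apply/mapP; exists i; rewrite ?mem_enum.
  have /asboolP[a aD aj] : `[< exists2 a, a \in D & a 0 j != 0 >].
    by move: jD; rewrite /= inE.
  split.
    by apply/mem_column_points; exists j.
  rewrite !inE negb_and; apply/orP; right; apply: contra aj => /forallP F0.
  have /span_subvP/subvP/(_ _ aD) : {subset [tuple values (F i) | i < r] <=
      (supported K (~: [set j]) : {vspace 'rV[K]_m})}.
    move=> _ /mapP[i _ ->]; apply/supportedP => l; rewrite !inE negbK => /eqP->.
    by apply/eqP; rewrite -(vanishes_atP _ (hF i)).
  by move=> /supportedP->; rewrite ?inE ?eqxx.
by rewrite card_imfset //= cardE.
Qed.

(** Evaluation identifies the span of the classes of the [F i] modulo [I] with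
    the subcode spanned by their words, and the points where some [F i] does
    not vanish with the support of that subcode. *)
Lemma is_gmd_ghw d r k : injective (fun j => <[col j A]>%VS) ->
  is_gmd X d r k <-> is_ghw (code A d) r k.
Proof.
move=> line_inj.
suff E l : (exists F : 'I_r -> {mpoly K[n.+1]}, [/\ forall i, F i \is d.-homog,
      is_dim_span_mod I F r & #|` (X `\` zeros X F)%fset| = l]) <->
    (exists D, [/\ (D <= code A d)%VS, \dim D = r & #|chi D| = l]).
  by split; apply: is_min_iff => l; split=> /E.
split=> [[F [hF [b [b_free bF _]] <-]]|[D [sD dD <-]]].
  exists <<[tuple values (F i) | i < r]>>%VS; split; last by rewrite (card_nonzeros _ hF).
    apply/span_subvP => _ /mapP[i _ ->].
    by apply/memv_code; exists (F i).
  apply/eqP; rewrite eqn_leq (leq_trans (dim_span _)) ?size_tuple //=.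
  have bv j : values (b j) \in <<[tuple values (F i) | i < r]>>%VS.
    have [c /values_vanishing/eqP] := bF j.
    rewrite linearB /= subr_eq0 => /eqP ->; rewrite linear_sum.
    apply: memv_suml => i _; rewrite linearZ; apply/rpredZ/memv_span/mapP.
    by exists i; rewrite ?mem_enum.
  have fb : free [tuple values (b j) | j < r].
    apply/freeP => c cb0; apply: b_free.
    (* The [b j] need not be homogeneous: they are replaced modulo [I] by
       combinations of the [F i], for which zero values mean membership. *)
    have [C bC] := choice bF.
    pose g := \sum_j c j *: \sum_i C j i *: F i.
    have -> : \sum_j c j *: b j = \sum_j c j *: (b j - \sum_i C j i *: F i) + g.
      rewrite -big_split; apply: eq_bigr => j _ /=.
      by rewrite -scalerDr subrK.
    apply: vanishing_idealD.
      by apply: vanishing_ideal_sum => j; apply: vanishing_idealZ.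
    have hg : g \is d.-homog.
      apply: rpred_sum => j _; apply: rpredZ.
      by apply: rpred_sum => i _; apply: rpredZ.
    apply/(vanishing_ideal_homog hg); rewrite -[RHS]cb0 linear_sum.
    apply: eq_bigr => j _; rewrite linearZ -tnth_nth tnth_mktuple.
    congr (_ *: _); apply/esym/eqP; rewrite -subr_eq0 -linearB.
    by apply/eqP/values_vanishing.
  rewrite -[X in (X <= _)%N](size_tuple [tuple values (b j) | j < r]) -(eqnP fb).
  by apply/dimvS/span_subvP => _ /mapP[j _ ->].
have [F HF] : exists F : 'I_r -> {mpoly K[n.+1]}, forall i,
    F i \is d.-homog /\ values (F i) = (vbasis D)`_i.
  suff /choice[F HF] : forall i : 'I_r, exists g : {mpoly K[n.+1]},
      g \is d.-homog /\ values g = (vbasis D)`_i by exists F.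
  move=> i; have /memv_code[g hg gi] : (vbasis D)`_i \in code A d.
    by apply/(subvP sD)/vbasis_mem/mem_nth; rewrite size_tuple dD.
  by exists g.
have hF i : F i \is d.-homog by case: (HF i).
have spanF : <<[tuple values (F i) | i < r]>>%VS = D.
  rewrite -[RHS](span_basis (vbasisP D)); congr <<_>>%VS.
  apply: (@eq_from_nth _ 0) => [|i]; rewrite !size_tuple ?dD // => lt_ir.
  rewrite -[i]/(val (Ordinal lt_ir)) -tnth_nth tnth_mktuple.
  by case: (HF (Ordinal lt_ir)).
exists F; split=> //; last by rewrite (card_nonzeros _ hF) ?spanF.
exists F; split=> [c||].
- have hg : \sum_j c j *: F j \is d.-homog.
    by apply: rpred_sum => j _; apply: rpredZ.
  move=> /(vanishing_ideal_homog hg) c0.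
  have /freeP : free [tuple values (F i) | i < r].
    by rewrite /free spanF size_tuple dD.
  apply; rewrite -[RHS]c0 linear_sum; apply: eq_bigr => j _.
  by rewrite linearZ -tnth_nth tnth_mktuple.
- move=> j; exists (fun i => (i == j)%:R).
  rewrite (bigD1 j) //= eqxx scale1r big1 ?addr0 ?subrr; last first.
    by move=> i /negPf->; rewrite scale0r.
  exact: vanishing_ideal0.
- move=> j; exists (fun i => (i == j)%:R).
  rewrite (bigD1 j) //= eqxx scale1r big1 ?addr0 ?subrr; last first.
    by move=> i /negPf->; rewrite scale0r.
  exact: vanishing_ideal0.
Qed.

End Evaluation.

(** * Alternating vertex labellings of a graph *)

Lemma card_setI_pair (T : finType) (x y : T) (U : {set T}) : x != y ->
  #|[set x; y] :&: U| = ((x \in U) + (y \in U))%N.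
Proof.
move=> xy; rewrite -sum1_card.
under eq_bigl do rewrite inE.
rewrite big_mkcondr big_setU1 ?inE //= big_set1.
by case: (x \in U); case: (y \in U).
Qed.

Section Alternating.
Variables (K : fieldType) (n : nat) (H : sgraph n.+1).
Implicit Types (u : 'rV[K]_n.+1) (x y : 'I_n.+1).

Definition component x := [set y | connect (adj H) x y].

Lemma adj_neq x y : adj H x y -> x != y.
Proof. by move/(forall_inP (edges_card2 H)); rewrite cards2; case: (x != y). Qed.

Lemma edge_pair e : e \in edges H -> exists x y, adj H x y /\ e = [set x; y].
Proof.
move=> eH; have /cards2P[x [y [_ E]]] := forall_inP (edges_card2 H) e eH.
by exists x, y; rewrite /adj -E.
Qed.

Lemma connect_adj_sym : connect_sym (adj H).
Proof. by apply: sym_connect_sym => x y; rewrite /adj setUC. Qed.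

Lemma component_refl x : x \in component x.
Proof. by rewrite inE. Qed.

Lemma component_eq x y : y \in component x -> component y = component x.
Proof.
rewrite inE => xy; apply/setP => z; rewrite !inE.
exact/esym/(same_connect connect_adj_sym).
Qed.

Lemma mem_components x : component x \in components H.
Proof. exact: imset_f. Qed.

Lemma componentsP C x : C \in components H -> x \in C -> C = component x.
Proof. by case/imsetP => y _ -> /component_eq. Qed.

Lemma adj_component C x y :
  C \in components H -> adj H x y -> (x \in C) = (y \in C).
Proof.
case/imsetP => z _ -> /connect1 xy; rewrite !inE.
exact: (same_connect_r connect_adj_sym).
Qed.

Definition alternating u := forall x y, adj H x y -> u 0 x + u 0 y = 0.

Lemma alternating_connect u x y :
  alternating u -> connect (adj H) x y -> u 0 y = u 0 x \/ u 0 y = - u 0 x.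
Proof.
move=> alt_u /connectP[p]; elim: p x => [|z p IH] x /=; first by move=> _ ->; left.
case/andP => xz /IH{}IH /IH; have/eqP := alt_u _ _ xz.
rewrite addrC addr_eq0 => /eqP ->; rewrite opprK.
by case; [right | left].
Qed.

Lemma alternating_eq0 u x y :
  alternating u -> connect (adj H) x y -> u 0 x = 0 -> u 0 y = 0.
Proof.
by move=> alt_u /(alternating_connect alt_u)[] -> ->; rewrite ?oppr0.
Qed.

(** On a component an alternating labelling is determined up to sign by any of
    its values, and restricting it to a component keeps it alternating; so each
    component carrying a nonzero labelling accounts for one dimension. *)
Lemma dim_alternating (V : {vspace 'rV[K]_n.+1}) (B : {set {set 'I_n.+1}}) :
    (forall u, u \in V <-> alternating u) ->
    B \subset components H ->
    (forall C, C \in B ->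
       exists u x, [/\ alternating u, x \in C & u 0 x != 0]) ->
    (forall u x, alternating u -> u 0 x != 0 -> component x \in B) ->
  \dim V = #|B|.
Proof.
move=> memV /subsetP sB nzB Bnz.
pose rep (C : {set 'I_n.+1}) := odflt ord0 [pick x in C].
have repP C : C \in B -> rep C \in C.
  move=> /sB/imsetP[x _ ->]; rewrite /rep; case: pickP => [//|/(_ x)].
  by rewrite component_refl.
(* The coordinates are the labels at one chosen vertex per component. *)
apply: (@dim_dual_coordinates _ _ _ _ _ rep) => [u /memV alt_u u0|C CB].
  apply/rowP => x; rewrite mxE; apply/eqP; apply/negPn/negP => ux.
  have xB := Bnz _ _ alt_u ux; move/negP: ux; apply; apply/eqP.
  apply: (@alternating_eq0 _ (rep (component x))) => //; last exact: u0.
  by have := repP _ xB; rewrite inE connect_adj_sym.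
have [u [x [alt_u xC ux]]] := nzB C CB.
exists (\row_y (if y \in C then u 0 y else 0)); split.
- apply/memV => y z yz; rewrite !mxE -(adj_component (sB _ CB) yz).
  by case: ifP => _; rewrite ?addr0 // alt_u.
- rewrite mxE repP //; apply: contra ux => /eqP urep.
  apply/eqP/(alternating_eq0 alt_u _ urep).
  by rewrite (componentsP (sB _ CB) (repP _ CB)) inE in xC.
- move=> C' C'B; rewrite mxE; case: ifP => // repC /eqP[].
  by rewrite (componentsP (sB _ CB) repC) -(componentsP (sB _ C'B)) ?repP.
Qed.

(** The labelling [w] is nonzero on every component; such a [w] exists in
    characteristic two and on bipartite graphs. *)
Lemma dim_alternating_components (V : {vspace 'rV[K]_n.+1}) w :
    (forall u, u \in V <-> alternating u) ->
    alternating w -> (forall x, w 0 x != 0) ->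
  \dim V = #|components H|.
Proof.
move=> memV alt_w nz_w; apply: dim_alternating => // [C|u x _ _].
  by case/imsetP => x _ ->; exists w, x; split; rewrite ?component_refl.
exact: mem_components.
Qed.

(** Away from characteristic two a nonzero value and its opposite differ, so a
    labelling that is nonzero on a component two-colours it. *)
Lemma dim_alternating_bipartite (V : {vspace 'rV[K]_n.+1}) :
    2%N \notin [pchar K] -> (forall u, u \in V <-> alternating u) ->
  \dim V = #|bipartite_components H|.
Proof.
move=> char2 memV.
have neq_opp (a : K) : a != 0 -> (- a == a) = false.
  move=> a0; apply/negP; rewrite eq_sym -addr_eq0 -mulr2n -mulr_natl mulf_eq0.
  by rewrite (negPf a0) orbF => two0; move: char2; rewrite inE /= two0.
apply: dim_alternating => //.
- by apply/subsetP => C; rewrite inE => /andP[].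
- move=> C; rewrite inE => /andP[Ccomp /existsP[U /forall_inP bipU]].
  have [x _ Cx] := imsetP Ccomp.
  exists (\row_y if y \in C then (-1) ^+ (y \in U) else 0), x; split.
  + move=> y z yz; rewrite !mxE -(adj_component Ccomp yz).
    case: ifP => yC; last by rewrite addr0.
    have := bipU [set y; z]; rewrite inE -[_ \in edges H]/(adj H y z) yz /=.
    rewrite subUset !sub1set -(adj_component Ccomp yz) yC => /(_ isT).
    rewrite card_setI_pair ?(adj_neq yz) //.
    by case: (y \in U); case: (z \in U) => //= _; rewrite ?subrr ?addNr.
  + by rewrite Cx component_refl.
  + by rewrite mxE Cx component_refl signr_eq0.
- move=> u x alt_u ux; rewrite inE mem_components; apply/existsP.
  exists [set y | u 0 y == u 0 x]; apply/forall_inP => e; rewrite inE.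
  case/andP => /edge_pair[y [z [yz ->]]]; rewrite subUset !sub1set inE.
  case/andP => xy _; rewrite card_setI_pair ?(adj_neq yz) // !inE.
  have /eqP := alt_u _ _ yz; rewrite addrC addr_eq0 => /eqP ->.
  have [->|->] := alternating_connect alt_u xy; rewrite ?opprK eqxx.
    by rewrite neq_opp.
  by rewrite neq_opp.
Qed.

End Alternating.

(** * Codes of incidence matrices *)

Section Incidence.
Variables (K : fieldType) (n m : nat) (G : sgraph n.+1).
Variable f : 'I_m -> {set 'I_n.+1}.
Hypotheses (f_inj : injective f) (f_edges : [set f j | j : 'I_m] = edges G).

Local Notation A := (incidence K f).
Local Notation phi := (linear_forms A).

Lemma edge_endpoints j : exists x y, x != y /\ f j = [set x; y].
Proof.
have : f j \in edges G by rewrite -f_edges imset_f.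
by case/edge_pair => x [y [xy ->]]; exists x, y; rewrite (adj_neq xy).
Qed.

Lemma incidence_col_neq0 j : col j A != 0.
Proof.
have [x [y [_ E]]] := edge_endpoints j; apply/eqP => /colP/(_ x)/eqP.
by rewrite !mxE E !inE eqxx oner_eq0.
Qed.

(** Proportional columns have the same support, and the support of a column is
    the edge itself. *)
Lemma incidence_line_inj : injective (fun j => <[col j A]>%VS).
Proof.
have sub j l : <[col j A]>%VS = <[col l A]>%VS -> f j \subset f l.
  move=> E; apply/subsetP => i ij.
  have : col j A \in <[col l A]>%VS by rewrite -E memv_line.
  case/vlineP => c /colP/(_ i)/eqP; rewrite !mxE ij.
  by case: (i \in f l); rewrite // mulr0 oner_eq0.
by move=> j l E; apply/f_inj/eqP; rewrite eqEsubset !sub.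
Qed.

Lemma mulmx_incidence (u : 'rV[K]_n.+1) j x y :
  x != y -> f j = [set x; y] -> (u *m A) 0 j = u 0 x + u 0 y.
Proof.
move=> xy E; rewrite mxE.
transitivity (\sum_(i in [set x; y]) u 0 i); last first.
  by rewrite big_setU1 ?inE //= big_set1.
rewrite [RHS]big_mkcond; apply: eq_bigr => i _; rewrite mxE E.
by case: ifP; rewrite ?mulr1 ?mulr0.
Qed.

(** Words of the code vanishing off [J] come from labellings that alternate
    along every edge outside [f @: J]. *)
Lemma preim_supportedP (J : {set 'I_m}) (u : 'rV[K]_n.+1) :
  u \in (phi @^-1: supported K J)%VS <-> alternating (remove_edges G (f @: J)) u.
Proof.
rewrite -memv_preim linear_formsE; split => [/supportedP uJ x y xy|alt_u].
  have := adj_neq xy; move: xy; rewrite /adj /= inE -f_edges => /andP[+ /imsetP[j _ E]].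
  rewrite E mem_imset // => /uJ <- xy.
  by rewrite (mulmx_incidence _ xy).
apply/supportedP => j jJ; have [x [y [xy E]]] := edge_endpoints j.
rewrite (mulmx_incidence _ xy E); apply: alt_u.
by rewrite /adj /= -E inE mem_imset // jJ -f_edges imset_f.
Qed.

(** The monomial [x^(d-1) y] separates the edge [{x, y}] from all others. *)
Lemma code_ge2 d : (2 <= d)%N -> code A d = fullv.
Proof.
move=> d2; apply/eqP; rewrite eqEsubv subvf /=; apply/subvP => a _.
rewrite [a]row_sum_delta memv_suml // => j _; apply: rpredZ.
have [x [y [xy E]]] := edge_endpoints j.
apply/memv_code; exists ('X_x ^+ d.-1 * 'X_y).
  suff : ('X_x ^+ d.-1 * 'X_y : {mpoly K[n.+1]}) \is (1 * d.-1 + 1).-homog.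
    by rewrite mul1n addn1 prednK // ltnW.
  by apply: dhomogM; [apply: dhomogMn|]; rewrite dhomogX /= mdeg1.
apply/rowP => l; rewrite !mxE mevalM rmorphXn /= !mevalXU !mxE /=.
have -> : (l == j) = (x \in f l) && (y \in f l).
  apply/eqP/andP => [->|[xl yl]]; first by rewrite E !inE !eqxx orbT.
  have [x' [y' [_ E']]] := edge_endpoints l; apply/f_inj; rewrite E E'.
  move: xl yl xy; rewrite E' !inE.
  case/orP => /eqP->; case/orP => /eqP->; rewrite ?eqxx // => _.
  by rewrite setUC.
case: (x \in f l); case: (y \in f l); rewrite /= ?mulr0 ?mul0r ?expr1n ?mulr1 //.
by case: d d2 => [|[|d]] //= _; rewrite expr0n.
Qed.

End Incidence.

Section EdgeRemoval.
Variables (K : fieldType) (n m : nat) (G : sgraph n.+1).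
Variable f : 'I_m -> {set 'I_n.+1}.
Hypotheses (f_inj : injective f) (f_edges : [set f j | j : 'I_m] = edges G).

Local Notation A := (incidence K f).
Local Notation phi := (linear_forms A).

(** The labellings alternating off [f @: J] map onto the words of the code
    supported on [J], with the labellings alternating on all of [G] as
    kernel; hence the shift by [N set0]. *)
Lemma ghw_edge_removal (N : {set {set 'I_n.+1}} -> nat) r :
    (forall J, \dim (phi @^-1: supported K J)%VS = N (f @: J)) ->
    (r + N set0 <= n.+1)%N ->
  exists k, is_ghw (code A 1) r k /\
    is_min (fun l => exists D : {set {set 'I_n.+1}},
      [/\ D \subset edges G, N D = (r + N set0)%N & #|D| = l]) k.
Proof.
move=> dimN rN; rewrite code_linear_forms.
have kerN : \dim (lker phi) = N set0.
  by have := dimN set0; rewrite imset0 supported0 lpreim0.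
have dimJ (J : {set 'I_m}) : N (f @: J) = (\dim (limg phi :&: supported K J) + N set0)%N.
  have sker : (lker phi <= phi @^-1: supported K J)%VS.
    by rewrite -lpreim0 lpreimS ?sub0v.
  have := limg_ker_dim phi (phi @^-1: supported K J).
  rewrite dimN (capv_idPr sker) kerN -lpreim_cap_limg lpreimK ?capvSr //.
  by rewrite addnC capvC.
have rC : (r <= \dim (limg phi))%N.
  rewrite -(leq_add2r (N set0)) (leq_trans rN) //.
  have := limg_ker_dim phi fullv.
  by rewrite capfv kerN dimvf dim_matrix mul1r addnC => ->.
have [k kmin] := exists_ghw rC; exists k; split=> //.
apply: is_min_iff (iffLR (is_ghw_supported _ _ _) kmin) => l.
split=> [[J [dJ <-]]|[D [sD dD <-]]].
  exists (f @: J); rewrite card_imset // dimJ dJ; split=> //.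
  by rewrite -f_edges; apply/subsetP => _ /imsetP[j _ ->]; apply: imset_f.
have ED : f @: (f @^-1: D) = D.
  apply/setP => e; apply/imsetP/idP => [[j + ->]|eD]; first by rewrite inE.
  have := subsetP sD e eD; rewrite -f_edges => /imsetP[j _ E].
  by exists j; rewrite // inE -E.
exists (f @^-1: D); split; last by rewrite -[in RHS]ED card_imset.
by apply/eqP; rewrite -(eqn_add2r (N set0)) -dimJ ED dD.
Qed.

Hypothesis G_conn : connected G.

Lemma components_remove0 : #|components (remove_edges G set0)| = 1%N.
Proof. by apply/eqP; move: G_conn; rewrite /connected /components /adj /= setD0. Qed.

Lemma bipartite_components_remove0 :
  ~~ bipartite G -> #|bipartite_components (remove_edges G set0)| = 0%N.
Proof.
move=> nbip; apply/eqP; rewrite cards_eq0 -subset0; apply/subsetP => C.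
rewrite inE => /andP[Cc /existsP[U /forall_inP bipU]]; case/negP: nbip.
have /eqP/cards1P[C0 E0] := components_remove0.
have CT x : x \in C.
  have := mem_components (remove_edges G set0) x; move: Cc; rewrite E0 !inE.
  by move=> /eqP-> /eqP<-; apply: component_refl.
apply/existsP; exists U; apply/forall_inP => e eG; apply: bipU.
by rewrite !inE eG /=; apply/subsetP => x _.
Qed.

Lemma bipartite_alternating : bipartite G ->
  exists2 w : 'rV[K]_n.+1, (forall D, alternating (remove_edges G D) w)
                         & forall x, w 0 x != 0.
Proof.
case/existsP => U /forall_inP bipU; exists (\row_x (-1) ^+ (x \in U)); last first.
  by move=> x; rewrite mxE signr_eq0.
move=> D x y xy; have neq_xy := adj_neq xy.
move: xy; rewrite /adj /= inE => /andP[_ /bipU].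
rewrite card_setI_pair // !mxE.
by case: (x \in U); case: (y \in U) => //= _; rewrite ?subrr ?addNr.
Qed.

(** One nowhere zero alternating labelling makes every component count, and
    the labellings of the connected graph [G] itself form a line. *)
Lemma ghw_edge_connectivity r (w : 'rV[K]_n.+1) :
    (forall D, alternating (remove_edges G D) w) -> (forall x, w 0 x != 0) ->
    (r <= n)%N ->
  exists k, is_ghw (code A 1) r k /\ is_edge_connectivity G r k.
Proof.
move=> alt_w nz_w rn.
have [||k] := @ghw_edge_removal (fun D => #|components (remove_edges G D)|) r.
- move=> J; apply: dim_alternating_components (alt_w _) nz_w => u.
  exact: preim_supportedP.
- by rewrite components_remove0 addn1.
by rewrite components_remove0 addn1 => ghw_k; exists k.
Qed.

Lemma ghw_weak_edge_biparticity r :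
    2%N \notin [pchar K] -> ~~ bipartite G -> (r <= n.+1)%N ->
  exists k, is_ghw (code A 1) r k /\ is_weak_edge_biparticity G r k.
Proof.
move=> char2 nbip rn.
have [||k] :=
  @ghw_edge_removal (fun D => #|bipartite_components (remove_edges G D)|) r.
- move=> J; apply: dim_alternating_bipartite char2 _ => u.
  exact: preim_supportedP.
- by rewrite bipartite_components_remove0 ?addn0.
by rewrite bipartite_components_remove0 ?addn0 // => ghw_k; exists k.
Qed.

End EdgeRemoval.

(* G has s = n.+1 vertices (a connected graph has at least one vertex);
   f_0, ..., f_(m-1) is an arbitrary listing of its edges. *)
Theorem mainTheorem1 (K : fieldType) (n m : nat) (G : sgraph n.+1)
  (f : 'I_m -> {set 'I_n.+1})
  (f_inj : injective f) (f_edges : [set f j | j : 'I_m] = edges G)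
  (G_conn : connected G) (d r : nat) :
  let A := incidence K f in
  let X := column_points A in
  [/\ d = 1%N -> 2%N \notin [pchar K] -> ~~ bipartite G ->
        (1 <= r <= n.+1)%N ->
        exists k, [/\ is_gmd X d r k, is_ghw (code A d) r k
                    & is_weak_edge_biparticity G r k],
      d = 1%N -> 2%N \in [pchar K] -> (1 <= r <= n)%N ->
        exists k, [/\ is_gmd X d r k, is_ghw (code A d) r k
                    & is_edge_connectivity G r k],
      d = 1%N -> bipartite G -> (1 <= r <= n)%N ->
        exists k, [/\ is_gmd X d r k, is_ghw (code A d) r k
                    & is_edge_connectivity G r k]
    & (2 <= d)%N -> (1 <= r <= m)%N ->
        is_gmd X d r r /\ is_ghw (code A d) r r].
Proof.
move=> A X.
have gmd k : is_gmd X d r k <-> is_ghw (code A d) r k.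
  have line_inj := @incidence_line_inj K n m f f_inj.
  exact: (is_gmd_ghw (incidence_col_neq0 K f_edges) d r k line_inj).
split=> [d1 char2 nbip|d1 char2|d1 bip|d2] /andP[_ rn].
- have [k [ghw_k min_k]] := ghw_weak_edge_biparticity f_inj f_edges G_conn char2 nbip rn.
  by exists k; split=> //; [apply/gmd|]; rewrite d1.
- have [D x y _|x|k [ghw_k min_k]] := @ghw_edge_connectivity K n m G f
      f_inj f_edges G_conn r (const_mx 1) _ _ rn.
  (* In characteristic two the constant labelling 1 alternates. *)
  + by rewrite !mxE -mulr2n (pcharf0 char2).
  + by rewrite mxE oner_eq0.
  by exists k; split=> //; [apply/gmd|]; rewrite d1.
- have [w alt_w nz_w] := bipartite_alternating K bip.
  have [k [ghw_k min_k]] := ghw_edge_connectivity f_inj f_edges G_conn alt_w nz_w rn.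
  by exists k; split=> //; [apply/gmd|]; rewrite d1.
- have ghw_r : is_ghw (code A d) r r.
    by rewrite (code_ge2 K f_inj f_edges d2); apply: is_ghw_fullv.
  by split; first exact/gmd.
Qed.
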